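(* Let $\mathbf a=(a_\ell)_{\ell\ge0}$, $\mathbf b=(b_{\ell,\ell'})_{\ell,\ell'\ge0}$ and $\lambda$ be indeterminates, let $\widetilde Q_{n,k}$ be as defined below, and let $\boldsymbol\alpha=(\alpha_n)_{n\ge1}$ with $$\alpha_n=(\lambda+n-1)\,a_{n-1}\Bigl(\sum_{\ell=0}^{n-1}b_{\ell,n-1-\ell}\Bigr).$$ Then for all $n,k\ge0$, $\widetilde Q_{n,k}=\Bigl(\prod_{i=0}^{k-1}a_i\Bigr)J_{n,k}(\boldsymbol\alpha,\mathbf 0)$.
   Context: $J_{n,k}(\boldsymbol\beta,\boldsymbol\gamma)$ is the generating polynomial of lattice paths from $(0,0)$ to $(n,k)$ staying in $\mathbb Z\times\mathbb N$ with steps $(1,1)$ (weight 1), $(1,-1)$ (weight $\beta_i$ when falling from height $i$) and $(1,0)$ (weight $\gamma_i$ at height $i$); with $\boldsymbol\gamma=\mathbf 0$ only paths without level steps contribute. A Laguerre digraph on $[n]$ is a directed graph on $[n]$ (loops allowed) with all in- and out-degrees in $\{0,1\}$; its components are directed paths (isolated vertices included) and directed cycles (loops included); $\mathrm{cyc}(G)$ is the number of cycles. With $\infty$–$\infty$ boundary conditions, $p(i)$ is the predecessor of $i$ (or $\infty$ if in-degree 0), $s(i)$ the successor (or $\infty$ if out-degree 0), $\infty$ exceeding all integers. $i$ is a peak if $p(i)<i>s(i)$, valley if $p(i)>i<s(i)$, double ascent if $p(i)<i<s(i)$, double descent if $p(i)>i>s(i)$, fixed point if $p(i)=i=s(i)$;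 $\mathrm{Peak}(G)$, $\mathrm{Val}(G)$ are the sets of peaks and valleys. $G$ is alternating if it has no double ascents, double descents or fixed points; $\mathbf{LD}^{\rm alt\infty}_{n,k}$ is the set of alternating Laguerre digraphs on $[n]$ with exactly $k$ paths. For $k\in[n]$: $\mathrm{lcross}(k,G)=\#\{(i,j,l): i,j\in[n], l\in[n]\cup\{\infty\}, i<j<k<l, p(i)=k, p(j)=l\}$, $\mathrm{lnest}(k,G)=\#\{(i,j,l): i,j\in[n], l\in[n]\cup\{\infty\}, i<j<k<l, p(j)=k, p(i)=l\}$. For $j\in[n]$: $\mathrm{ulev}(j,G)=\#\{i\in[n]: i<j<s(i)\}$ if $j<s(j)$, and $0$ otherwise. Finally $\widetilde Q_{n,k}=\sum_{G\in\mathbf{LD}^{\rm alt\infty}_{n,k}}\lambda^{\mathrm{cyc}(G)}\prod_{i\in\mathrm{Val}(G)}a_{\mathrm{ulev}(i,G)}\prod_{i\in\mathrm{Peak}(G)}b_{\mathrm{lcross}(i,G),\mathrm{lnest}(i,G)}$. *)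

(* Defs.v *)
From HB Require Import structures.
From mathcomp Require Import all_boot all_order all_algebra.
Set Implicit Arguments.
Unset Strict Implicit.
Unset Printing Implicit Defensive.
Import Order.TTheory GRing.Theory Num.Theory.
Local Open Scope ring_scope.

Inductive mstep := Rise | Level | Fall.

Definition mstep_code (s : mstep) : option bool :=
  match s with Rise => Some true | Level => None | Fall => Some false end.
Definition mstep_decode (c : option bool) : mstep :=
  match c with Some true => Rise | None => Level | Some false => Fall end.
Lemma mstep_codeK : cancel mstep_code mstep_decode. Proof. by case. Qed.
HB.instance Definition _ := Finite.copy mstep (can_type mstep_codeK).

Definition dy (s : mstep) : int :=
  match s with Rise => 1 | Level => 0 | Fall => -1 end.

(* Every step advances the abscissa by 1, so a path from (0,0) to (n,k) is a
   word of n steps; [height w m] is the ordinate at abscissa m. *)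
Definition height (w : seq mstep) (m : nat) : int := \sum_(s <- take m w) dy s.

Definition is_lattice_path (n k : nat) (w : n.-tuple mstep) : bool :=
  [forall m : 'I_n.+1, 0 <= height w m] && (height w n == k%:Z).

(* On lattice paths heights are nonnegative, so [absz] is exact. *)
Definition path_weight (R : comNzRingType) (beta gamma : nat -> R) (n : nat)
    (w : n.-tuple mstep) : R :=
  \prod_(m < n) match tnth w m with
                | Rise => 1
                | Level => gamma `|height w m|%N
                | Fall => beta `|height w m|%N
                end.

Definition J (R : comNzRingType) (n k : nat) (beta gamma : nat -> R) : R :=
  \sum_(w : n.-tuple mstep | is_lattice_path k w) path_weight beta gamma w.

(* The vertex set [n] is represented by 'I_n = {0, ..., n-1}: only the relative
   order of the labels is ever used. *)
Definition digraph (n : nat) := {set 'I_n * 'I_n}.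

Section LaguerreDigraphs.
Variables (n : nat) (G : digraph n).
Implicit Types (i j k : 'I_n) (C : {set 'I_n}).

Definition indeg i : nat := #|[set j | (j, i) \in G]|.
Definition outdeg i : nat := #|[set j | (i, j) \in G]|.

Definition is_laguerre : bool :=
  [forall i, (indeg i <= 1)%N && (outdeg i <= 1)%N].

Definition adjacent : rel 'I_n :=
  [rel i j | ((i, j) \in G) || ((j, i) \in G)].

Definition components : {set {set 'I_n}} :=
  equivalence_partition (connect adjacent) [set: 'I_n].

Definition induced_edges C : digraph n :=
  [set e in G | (e.1 \in C) && (e.2 \in C)].

(* The subgraph induced on C is t_0 -> t_1 -> ... -> t_(m-1). *)
Definition is_dipath C : bool :=
  [exists t : #|C|.-tuple 'I_n,
    [&& uniq t, [set x in t] == C &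
        induced_edges C == [set e in zip t (behead t)]]].

(* The subgraph induced on C is t_0 -> t_1 -> ... -> t_(m-1) -> t_0. *)
Definition is_dicycle C : bool :=
  [exists t : #|C|.-tuple 'I_n,
    [&& uniq t, [set x in t] == C &
        induced_edges C == [set e in zip t (rot 1 t)]]].

Definition cyc : nat := #|[set C in components | is_dicycle C]|.
Definition npaths : nat := #|[set C in components | is_dipath C]|.

(* [None] stands for infinity, larger than every vertex. *)
Definition lt_inf (x y : option 'I_n) : bool :=
  match x, y with
  | Some i, Some j => (i < j)%N
  | Some _, None => true
  | None, _ => false
  end.

(* When [is_laguerre] holds, the picked vertex is the only candidate. *)
Definition pred_inf i : option 'I_n := [pick j | (j, i) \in G].
Definition succ_inf i : option 'I_n := [pick j | (i, j) \in G].

Definition is_peak i :=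
  lt_inf (pred_inf i) (Some i) && lt_inf (succ_inf i) (Some i).
Definition is_valley i :=
  lt_inf (Some i) (pred_inf i) && lt_inf (Some i) (succ_inf i).
Definition is_dasc i :=
  lt_inf (pred_inf i) (Some i) && lt_inf (Some i) (succ_inf i).
Definition is_ddesc i :=
  lt_inf (Some i) (pred_inf i) && lt_inf (succ_inf i) (Some i).
Definition is_fixpt i :=
  (pred_inf i == Some i) && (succ_inf i == Some i).

Definition Peak : {set 'I_n} := [set i | is_peak i].
Definition Val : {set 'I_n} := [set i | is_valley i].

Definition alternating : bool :=
  [forall i, [&& ~~ is_dasc i, ~~ is_ddesc i & ~~ is_fixpt i]].

Definition lcross k : nat :=
  #|[set x : 'I_n * 'I_n * option 'I_n | let: (i, j, l) := x in
      [&& (i < j)%N, (j < k)%N, lt_inf (Some k) l,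
          pred_inf i == Some k & pred_inf j == l]]|.

Definition lnest k : nat :=
  #|[set x : 'I_n * 'I_n * option 'I_n | let: (i, j, l) := x in
      [&& (i < j)%N, (j < k)%N, lt_inf (Some k) l,
          pred_inf j == Some k & pred_inf i == l]]|.

Definition ulev j : nat :=
  if lt_inf (Some j) (succ_inf j)
  then #|[set i : 'I_n | (i < j)%N && lt_inf (Some j) (succ_inf i)]|
  else 0%N.

End LaguerreDigraphs.

Definition LDalt (n k : nat) : {set digraph n} :=
  [set G : digraph n | [&& is_laguerre G, alternating G & npaths G == k]].

Definition Qtilde (R : comNzRingType) (a : nat -> R) (b : nat -> nat -> R)
    (lam : R) (n k : nat) : R :=
  \sum_(G in LDalt n k)
    lam ^+ cyc G * (\prod_(i in Val G) a (ulev G i))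
                 * (\prod_(i in Peak G) b (lcross G i) (lnest G i)).

(* Main.v *)
Require Import Defs.
From mathcomp Require Import all_boot all_order all_algebra ring.
Set Implicit Arguments.
Unset Strict Implicit.
Unset Printing Implicit Defensive.
Import Order.TTheory GRing.Theory Num.Theory.

(* Delete the largest vertex of an alternating Laguerre digraph on n+1 vertices
   with k paths.  Either it is an isolated valley, of weight a_(k-1) since every
   other path end i has s(i) = infinity, or it is a peak, and its deletion leaves
   a digraph with k+1 paths in which its predecessor u is a path end and its
   successor v a path start; all other statistics are unchanged because the new
   label behaves like infinity for the old vertices.  Conversely, v ranges over
   the k+1 path starts, the peak having lcross (resp. lnest) the number of starts
   above (resp. below) v, and exactly one of the k+1 ends u closes a cycle.  Hence
     Q_(n+1,k) = a_(k-1) Q_(n,k-1) + (lam + k) (sum_l b_(l,k-l)) Q_(n,k+1),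
   which is the last-step recurrence of J, up to the product of the a_i.
   Cycles are counted as components minus paths. *)

(** [old i] has the same numerical value as [i]: the old vertices keep their labels and the new
    vertex [ord_max] lies above them all. *)
Local Notation old := (lift ord_max).

(** * Components of a Laguerre digraph *)

Definition component n (G : digraph n) (x : 'I_n) : {set 'I_n} :=
  [set y | connect (adjacent G) x y].

Definition starts n (G : digraph n) : {set 'I_n} := [set i | pred_inf G i == None].
Definition ends n (G : digraph n) : {set 'I_n} := [set i | succ_inf G i == None].

Section Components.
Variables (n : nat) (G : digraph n).

Lemma adjacent_sym : symmetric (adjacent G).
Proof. by move=> i j; rewrite /adjacent /= orbC. Qed.

Lemma connect_adjacent_sym : connect_sym (adjacent G).
Proof. exact/sym_connect_sym/adjacent_sym. Qed.

Lemma componentsE : components G = [set component G x | x in 'I_n].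
Proof.
rewrite /components /equivalence_partition.
apply/setP => C; apply/imsetP/imsetP => -[x _ ->]; exists x => //;
  by apply/setP => y; rewrite !inE.
Qed.

Lemma mem_component x y : (y \in component G x) = connect (adjacent G) x y.
Proof. by rewrite inE. Qed.

Lemma component_refl x : x \in component G x.
Proof. by rewrite inE connect0. Qed.

Lemma component_eq x y : (component G x == component G y) = connect (adjacent G) x y.
Proof.
apply/eqP/idP => [eqC|cxy]; first by rewrite -mem_component eqC component_refl.
by apply/setP => z; rewrite !inE (same_connect connect_adjacent_sym cxy).
Qed.

Lemma components_partition : partition (components G) [set: 'I_n].
Proof.
apply: equivalence_partitionP => x y z _ _ _; split; first exact: connect0.
by move=> cxy; rewrite (same_connect connect_adjacent_sym cxy).
Qed.

(** Serves to count path starts and path ends component by component. *)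
Lemma card_by_component (A : {set 'I_n}) :
  #|A| = \sum_(C in components G) #|A :&: C|.
Proof.
rewrite -sum1_card big_mkcond -(eq_bigl _ _ (in_setT (T := _))).
rewrite (set_partition_big _ components_partition) /=.
apply: eq_bigr => C _; rewrite -big_mkcondr -sum1_card.
by apply: eq_bigl => x; rewrite inE andbC.
Qed.

Lemma startsP i : reflect (forall j, (j, i) \notin G) (i \in starts G).
Proof.
rewrite inE /pred_inf; case: pickP => [j ji|no] /=; constructor; last by move=> j; rewrite no.
by move/(_ j); rewrite ji.
Qed.

Lemma endsP i : reflect (forall j, (i, j) \notin G) (i \in ends G).
Proof.
rewrite inE /succ_inf; case: pickP => [j ji|no] /=; constructor; last by move=> j; rewrite no.
by move/(_ j); rewrite ji.
Qed.

End Components.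

(** [zip (belast y p) p] is the list of consecutive pairs of the walk [y :: p], that is, of its
    edges. *)
Lemma path_zip_belast (T : eqType) (e : rel T) (y : T) (p : seq T) u v :
  path e y p -> (u, v) \in zip (belast y p) p -> e u v.
Proof.
elim: p y => [|z p IH] y //= /andP[eyz pzp]; rewrite inE => /predU1P[[-> ->]//|].
exact: IH.
Qed.

Lemma mem_zip_belast_cat (T : eqType) (y z : T) (p1 p2 : seq T) :
  (last y p1, z) \in zip (belast y (p1 ++ z :: p2)) (p1 ++ z :: p2).
Proof. by elim: p1 y => [|w p1 IH] y /=; rewrite inE ?eqxx // IH orbT. Qed.

Lemma zip_belast (T : Type) (y : T) (p : seq T) :
  zip (y :: p) p = zip (belast y p) p.
Proof. by elim: p y => [|z p IH] y //=; rewrite -IH. Qed.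

Lemma uniq_size_set (T : finType) (C : {set T}) (s : seq T) :
  uniq s -> [set x in s] = C -> size s = #|C|.
Proof. by move=> us <-; rewrite cardsE; apply/esym/card_uniqP. Qed.

Section Laguerre.
Variables (n : nat) (G : digraph n).
Hypothesis lagG : is_laguerre G.

Lemma laguerre_succ_inj i j k : (i, j) \in G -> (i, k) \in G -> j = k.
Proof.
move=> ij ik; have /andP[_ /card_le1_eqP o1] := forallP lagG i.
by apply: o1; rewrite inE.
Qed.

Lemma laguerre_pred_inj i j k : (i, k) \in G -> (j, k) \in G -> i = j.
Proof.
move=> ik jk; have /andP[/card_le1_eqP o1 _] := forallP lagG k.
by apply: o1; rewrite inE.
Qed.

Lemma succ_infE i j : (succ_inf G i == Some j) = ((i, j) \in G).
Proof.
rewrite /succ_inf; case: pickP => [k ik|no]; last by rewrite no.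
by apply/eqP/idP => [[<-]//|/laguerre_succ_inj/(_ ik)->].
Qed.

Lemma pred_infE i j : (pred_inf G j == Some i) = ((i, j) \in G).
Proof.
rewrite /pred_inf; case: pickP => [k ik|no]; last by rewrite no.
by apply/eqP/idP => [[<-]//|/laguerre_pred_inj/(_ ik)->].
Qed.

Let edge : rel 'I_n := [rel i j | (i, j) \in G].

(** Distinct vertices bound the length, so among the dipaths through [x] a longest one exists. *)
Lemma longest_dipath x : exists y p,
  [/\ uniq (y :: p), path edge y p, x \in y :: p &
      forall z q, uniq (z :: q) -> path edge z q -> x \in z :: q ->
        size q <= size p].
Proof.
(* [m] is the number of edges, hence the [m.+1] vertices. *)
pose P m := [exists t : m.+1.-tuple 'I_n,
  [&& uniq t, path edge (head x t) (behead t) & x \in (t : seq _)]].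
have exP : exists m, P m.
  by exists 0; apply/existsP; exists [tuple x]; rewrite /= inE eqxx.
have ubP m : P m -> m <= n.
  case/existsP => t /and3P[/card_uniqP ut _ _]; rewrite -ltnS ltnW // ltnS.
  by move: (max_card (mem t)); rewrite ut size_tuple card_ord.
case: (ex_maxnP exP ubP) => m /existsP[t /and3P[ut pt xt]] maxm.
case: t ut pt xt => -[//|y p] /= /eqP[sp] ut pt xt.
exists y, p; split => // z q uq pq xq; rewrite sp; apply: maxm.
by apply/existsP; exists (in_tuple (z :: q)); apply/and3P.
Qed.

(** Each shape records its starts and ends, because paths are later counted by them. *)
Variant component_shape_spec (x : 'I_n) : Prop :=
  | ComponentPath y p of uniq (y :: p) & [set z in y :: p] = component G x
      & induced_edges G (component G x) = [set e in zip (y :: p) p]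
      & starts G :&: component G x = [set y]
      & ends G :&: component G x = [set last y p]
  | ComponentCycle y p of uniq (y :: p) & [set z in y :: p] = component G x
      & induced_edges G (component G x) = [set e in zip (y :: p) (rcons p y)]
      & starts G :&: component G x = set0
      & ends G :&: component G x = set0.

Lemma component_shape x : component_shape_spec x.
Proof.
(* A longest dipath through x can only be continued from its end to its start,
   so its vertex set is closed under adjacency. *)
have [y [p [uyp pyp xyp maxp]]] := longest_dipath x.
(* A successor of the last vertex outside the dipath would lengthen it; one inside [p] would have
   two distinct predecessors. *)
have succ_last z : (last y p, z) \in G -> z = y.
  move=> lz; case: (boolP (z \in y :: p)) => [|zNp]; last first.
    suff: size (rcons p z) <= size p by rewrite size_rcons ltnn.
    apply: (maxp y); first by rewrite -rcons_cons rcons_uniq zNp.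
      by rewrite rcons_path pyp.
    by rewrite -rcons_cons mem_rcons inE xyp orbT.
  rewrite inE => /predU1P[//|zp]; exfalso.
  case/splitPr: zp uyp pyp lz => p1 p2; rewrite cat_path /= last_cat /=.
  move=> u /and3P[_ e1 _] /laguerre_pred_inj/(_ e1) eql.
  move: u; rewrite -/(uniq (y :: _)) -cat_cons cat_uniq => /and3P[_ /hasPn/(_ (last z p2)) H _].
  by move: H; rewrite mem_last eql mem_last => /(_ isT).
have pred_first z : (z, y) \in G -> z = last y p.
  move=> zy; case: (boolP (z \in y :: p)) => [|zNp]; last first.
    suff: size (y :: p) <= size p by rewrite ltnn.
    apply: (maxp z); first by rewrite cons_uniq zNp.
      by apply/andP; split.
    by rewrite inE xyp orbT.
  move=> zp; case/splitPl: zp uyp pyp => p1 [|w p2] lz.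
    by rewrite cats0 lz.
  rewrite cat_path /= lz => u /and3P[_ e1 _].
  have := laguerre_succ_inj zy e1 => eqy; move: u.
  by rewrite -eqy mem_cat inE eqxx orbT.
have succ_in w z : w \in y :: p -> (w, z) \in G ->
    (w, z) \in zip (belast y p) p \/ (w = last y p /\ z = y).
  move=> wp wz; case/splitPl: wp wz pyp succ_last => p1 [|w' p2] <- wz.
    by rewrite cats0 => _ /(_ z) H; right; split=> //; apply: H.
  rewrite cat_path /= => /and3P[_ e1 _] _; left.
  by rewrite (laguerre_succ_inj wz e1) mem_zip_belast_cat.
have zipG e : e \in zip (belast y p) p -> e \in G.
  by case: e => u v; apply: (path_zip_belast pyp).
have in_p u v : (u, v) \in zip (belast y p) p -> u \in y :: p /\ v \in p.
  elim: (p) (y) => [|w q IH] y' //=; rewrite inE => /predU1P[[-> ->]|/IH[uq vq]].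
    by rewrite !inE !eqxx.
  by rewrite in_cons uq orbT inE vq orbT.
have pred_ex z : z \in p -> exists2 u, u \in y :: p & (u, z) \in G.
  move=> zp; case/splitPr: zp zipG => p1 p2 zipG; exists (last y p1).
    by rewrite -cat_cons mem_cat mem_last.
  exact/zipG/mem_zip_belast_cat.
have pred_in w z : z \in y :: p -> (w, z) \in G -> w \in y :: p.
  rewrite inE => /predU1P[->/pred_first->|]; first exact: mem_last.
  by case/pred_ex => u up uz /laguerre_pred_inj/(_ uz)->.
have eqC : [set z in y :: p] = component G x.
  apply/setP => z; rewrite !inE -in_cons; apply/idP/idP => [zp|xz].
    have toy w : w \in y :: p -> connect (adjacent G) y w.
      move=> wp; have := path_connect pyp wp; apply: connect_sub => u v /= uv.
      by apply: connect1; apply/orP; left.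
    by apply: connect_trans (toy z zp); rewrite connect_adjacent_sym toy.
  have cl : closed (adjacent G) (mem (y :: p)).
    apply: (intro_closed (@connect_adjacent_sym _ G)) => u v /orP[uv|vu] up.
      case: (succ_in _ _ up uv) => [/in_p[_ vp]|[_ ->]]; last exact: mem_head.
      by rewrite inE vp orbT.
    exact: pred_in vu.
  by rewrite -(closed_connect cl xz).
have zip_cycle : zip (y :: p) (rcons p y) = rcons (zip (belast y p) p) (last y p, y).
  by rewrite lastI zip_rcons ?size_belast.
have memC z : (z \in component G x) = (z \in y :: p) by rewrite -eqC inE.
have last_end z : z \in y :: p -> z \in ends G -> z = last y p.
  move=> zp; case/splitPl: zp zipG => p1 [|w p2] <- zipG; first by rewrite cats0.
  by move/endsP/(_ w)/negP; case; exact/zipG/mem_zip_belast_cat.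
have first_start z : z \in y :: p -> z \in starts G -> z = y.
  by rewrite inE => /predU1P[//|/pred_ex[u _ uz]] /startsP/(_ u)/negP; case.
(* The edges inside the component are the consecutive pairs and possibly the closing edge, whose
   presence decides between cycle and path. *)
case: (boolP ((last y p, y) \in G)) => ly.
  right with y p => //.
  - apply/setP => -[u v]; rewrite !inE -!mem_component !memC zip_cycle mem_rcons in_cons.
    apply/andP/predU1P => [[uv /andP[/= up vp]]|[[-> ->]|uv]].
    + by case: (succ_in _ _ up uv) => [->|[-> ->]]; [right|left].
    + by rewrite ly mem_last mem_head.
    + by have [up vp] := in_p _ _ uv; rewrite zipG //= up inE vp orbT.
  - apply/setP => z; rewrite in_setI memC in_set0; apply/negP => /andP[zs zp].
    by move: (zs); rewrite (first_start z zp zs) => /startsP/(_ (last y p)); rewrite ly.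
  - apply/setP => z; rewrite in_setI memC in_set0; apply/negP => /andP[ze zp].
    by move: (ze); rewrite (last_end z zp ze) => /endsP/(_ y); rewrite ly.
left with y p => //.
- apply/setP => -[u v]; rewrite !inE -!mem_component !memC zip_belast.
  apply/andP/idP => [[uv /andP[/= up vp]]|uv].
    case: (succ_in _ _ up uv) => [//|[eu ev]].
    by rewrite eu ev (negPf ly) in uv.
  by have [up vp] := in_p _ _ uv; rewrite zipG //= up inE vp orbT.
- apply/setP => z; rewrite in_setI memC in_set1; apply/andP/eqP => [[]|->].
    by move=> zs zp; exact: first_start.
  rewrite mem_head; split=> //; apply/startsP => u.
  by apply: contra ly => uy; rewrite -(pred_first u).
- apply/setP => z; rewrite in_setI memC in_set1; apply/andP/eqP => [[]|->].
    by move=> zs zp; exact: last_end.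
  rewrite mem_last; split=> //; apply/endsP => u.
  by apply: contra ly => uy; move: (uy); rewrite (succ_last u uy).
Qed.

(** Edge counts make the two shapes exclusive: on [m] vertices a path has [m - 1] edges and a cycle
    has [m]. By [component_shape] one of them occurs, a path having one start and one end, a cycle
    none. *)
Lemma dipath_or_dicycle C : C \in components G ->
  [/\ is_dicycle G C = ~~ is_dipath G C,
      #|starts G :&: C| = is_dipath G C & #|ends G :&: C| = is_dipath G C].
Proof.
rewrite componentsE => /imsetP[x _ {C}->]; set C := component G x.
have C_gt0 : 0 < #|C| by apply/card_gt0P; exists x; exact: component_refl.
have card_zip (s t : seq 'I_n) : uniq s -> size t <= size s ->
    #|[set e in zip s t]| = size t.
  move=> us ts; rewrite cardsE; move/card_uniqP: (zip_uniql t us) => ->.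
  by rewrite size_zip; apply/minn_idPr.
have path_card : is_dipath G C -> #|induced_edges G C| = #|C|.-1.
  case/existsP => t /and3P[ut _ /eqP->].
  by rewrite card_zip // size_behead ?size_tuple // leq_pred.
have cycle_card : is_dicycle G C -> #|induced_edges G C| = #|C|.
  case/existsP => t /and3P[ut _ /eqP->].
  by rewrite card_zip // size_rot ?size_tuple.
have excl : is_dipath G C -> is_dicycle G C -> False.
  by move=> /path_card eqp /cycle_card; rewrite eqp => /eqP; rewrite ltn_eqF ?ltn_predL.
case: (component_shape x) => y p ut /[dup] eqC /(uniq_size_set ut)/eqP st eqE eqs eqe.
  have pC : is_dipath G C.
    apply/existsP; exists (Tuple st); apply/and3P; split=> //=; first exact/eqP.
    by rewrite eqE.
  rewrite eqs eqe !cards1 pC; split=> //.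
  by apply/negbTE/negP; exact: excl.
have cC : is_dicycle G C.
  apply/existsP; exists (Tuple st); apply/and3P; split=> //=; first exact/eqP.
  by rewrite rot1_cons eqE.
have /negPf -> : ~~ is_dipath G C by apply/negP => pC; exact: (excl pC cC).
by rewrite eqs eqe !cards0 cC.
Qed.

Lemma npaths_sum : npaths G = \sum_(C in components G) is_dipath G C.
Proof.
rewrite /npaths -sum1_card (eq_bigl _ _ (fun C => in_set _ C)) big_mkcondr.
by apply: eq_bigr => C _; case: is_dipath.
Qed.

Lemma npaths_starts : npaths G = #|starts G|.
Proof.
rewrite npaths_sum (card_by_component G).
by apply: eq_bigr => C /dipath_or_dicycle[].
Qed.

Lemma npaths_ends : npaths G = #|ends G|.
Proof.
rewrite npaths_sum (card_by_component G).
by apply: eq_bigr => C /dipath_or_dicycle[].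
Qed.

(** Cycles can thus be followed through an insertion by counting components and paths only. *)
Lemma cyc_npaths : cyc G + npaths G = #|components G|.
Proof.
rewrite addnC /npaths /cyc -(cardsID [set C | is_dipath G C] (components G)).
congr (_ + _); apply: eq_card => C; rewrite !inE //.
by case: (boolP (C \in _)) => [/dipath_or_dicycle[->]|]; rewrite ?andbT ?andbF.
Qed.

(** A component containing a start cannot be a cycle, so it is a path. This is why exactly one end
    closes a cycle when joined to [v]. *)
Lemma ends_of_start v : v \in starts G -> #|ends G :&: component G v| = 1.
Proof.
move=> vs; have Cv : component G v \in components G by rewrite componentsE imset_f.
have [_ cs ->] := dipath_or_dicycle Cv; rewrite -cs.
have : 0 < #|starts G :&: component G v|.
  by apply/card_gt0P; exists v; rewrite in_setI vs component_refl.
by rewrite cs; case: (is_dipath _ _).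
Qed.

End Laguerre.

(** * Adding a vertex *)

(** The image of a map is in bijection with the set of its fibres, and the two maps have the same
    fibres. *)
Lemma card_imset_fibers (T T1 T2 : finType) (f : T -> T1) (g : T -> T2) :
  (forall x y, (f x == f y) = (g x == g y)) ->
  #|[set f x | x in T]| = #|[set g x | x in T]|.
Proof.
have fibers (T' : finType) (k : T -> T') :
    #|[set k x | x in T]| = #|[set [set y | k x == k y] | x in T]|.
  rewrite (imset_comp (fun b => [set y | b == k y]) k) card_in_imset //.
  move=> _ b /imsetP[x _ ->] _ /setP/(_ x).
  by rewrite !inE eqxx => /esym/eqP.
move=> fg; rewrite (fibers _ f) (fibers _ g); congr #|pred_of_set _|; apply: eq_imset => x.
by apply/setP => y; rewrite !inE fg.
Qed.

(** * Number of components after adding a vertex *)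

Definition restrict n (H : digraph n.+1) : digraph n :=
  [set e | (old e.1, old e.2) \in H].

Section ComponentCount.
Variables (n : nat) (H : digraph n.+1).
Let G := restrict H.
Let N := [set x : 'I_n | adjacent H ord_max (old x)].

Let U := \bigcup_(x in N) component G x.

(** The trace on the old vertices of the component of [z] in [H]: either the union [U] of the
    components of [G] touching the new vertex, or an untouched component of [G]. *)
Let h (z : 'I_n.+1) : {set 'I_n} :=
  if unlift ord_max z is Some x then (if x \in U then U else component G x) else U.

Lemma connect_restrict x y :
  connect (adjacent G) x y -> connect (adjacent H) (old x) (old y).
Proof.
case/connectP => p; elim: p x => [|z p IH] x /=; first by move=> _ ->; exact: connect0.
move=> /andP[xz pzp] /(IH _ pzp); apply: connect_trans; apply: connect1.
by move: xz; rewrite /adjacent /= !inE.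
Qed.

(** The new vertex merges with all the components it touches into a single one, and the other
    components survive. *)
Lemma card_components_add_vertex :
  #|components H| + #|[set component G x | x in N]| = #|components G|.+1.
Proof.
have UP x : reflect (exists2 y, y \in N & connect (adjacent G) y x) (x \in U).
  apply: (iffP bigcupP) => -[y yN yx]; exists y => //.
    by rewrite -mem_component.
  by rewrite mem_component.
have U_max x : x \in U -> connect (adjacent H) ord_max (old x).
  case/UP => y; rewrite inE => yN /connect_restrict; apply: connect_trans.
  exact: connect1.
have U_closed x y : connect (adjacent G) x y -> x \in U -> y \in U.
  by move=> xy /UP[z zN zx]; apply/UP; exists z => //; apply: connect_trans xy.
have not_U x : x \notin U -> component G x != U.
  by apply: contra => /eqP <-; exact: component_refl.
have h_adj z z' : adjacent H z z' -> h z = h z'.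
  rewrite /h; case: (unliftP ord_max z) => [x ->|->];
    case: (unliftP ord_max z') => [x' ->|->] //; rewrite ?unlift_none ?liftK.
  - move=> xx'; have cxx' : connect (adjacent G) x x'.
      by apply: connect1; move: xx'; rewrite /adjacent /= !inE.
    have -> : (x' \in U) = (x \in U).
      apply/idP/idP; last exact: U_closed.
      by apply: U_closed; rewrite connect_adjacent_sym.
    by case: ifP => // _; apply/eqP; rewrite component_eq.
  - rewrite adjacent_sym => xN; suff -> : x \in U by [].
    by apply/UP; exists x; rewrite ?inE // connect0.
  - move=> xN; suff -> : x' \in U by [].
    by apply/UP; exists x'; rewrite ?inE // connect0.
(* [h] and [component H] have the same fibres, so the components of [H] can be counted as values of
   [h]. *)
have hP z z' : (component H z == component H z') = (h z == h z').
  rewrite component_eq; apply/idP/eqP.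
    case/connectP => p; elim: p z => [|w p IH] z /=; first by move=> _ ->.
    by move=> /andP[/h_adj -> pwp] /(IH _ pwp).
  rewrite /h; case: (unliftP ord_max z) => [x ->|->];
    case: (unliftP ord_max z') => [x' ->|->] //; rewrite ?unlift_none ?liftK.
  - case: ifPn => xU; case: ifPn => xU' eqh.
    + by apply: connect_trans (U_max _ xU'); rewrite connect_adjacent_sym U_max.
    + by have := not_U _ xU'; rewrite -eqh eqxx.
    + by have := not_U _ xU; rewrite eqh eqxx.
    + by apply: connect_restrict; rewrite -component_eq eqh.
  - case: ifPn => [xU _|/not_U /eqP nU]; last by move/nU.
    by rewrite connect_adjacent_sym U_max.
  - case: ifPn => [xU _|/not_U /eqP nU]; last by move/esym/nU.
    exact: U_max.
set K := [set component G x | x in N].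
have -> : #|components H| = #|U |: (components G :\: K)|.
  rewrite componentsE (card_imset_fibers hP); congr #|pred_of_set _|.
  have K_U x : (component G x \in K) = (x \in U).
    apply/imsetP/UP => -[y yN yx]; exists y => //.
      by move/eqP: yx; rewrite component_eq connect_adjacent_sym.
    by apply/eqP; rewrite component_eq connect_adjacent_sym.
  apply/setP => C; rewrite in_setU1 in_setD; apply/imsetP/predU1P.
    case=> z _ ->; rewrite /h; case: (unliftP ord_max z) => [x _|_]; last by left.
    case: ifPn => xU; [by left|right].
    by rewrite K_U xU componentsE imset_f.
  case=> [->|/andP[CK]]; first by exists ord_max; rewrite // /h unlift_none.
  rewrite componentsE => /imsetP[x _ eC]; exists (old x) => //.
  by rewrite /h liftK -K_U -eC (negPf CK).
have KC : K \subset components G.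
  by apply/subsetP => _ /imsetP[x _ ->]; rewrite componentsE imset_f.
rewrite cardsU1 cardsDS // in_setD.
(* If [U] is a component of [G], it is nonempty, hence it is the component of a neighbour of the new
   vertex and lies in [K]. So [U] adds one to the count. *)
have -> : (U \notin K) && (U \in components G) = false.
  apply/negP => /andP[UK]; rewrite componentsE => /imsetP[x _ eU].
  case/negP: UK; have /UP[y yN yx] : x \in U by rewrite eU component_refl.
  by apply/imsetP; exists y => //; rewrite eU; apply/esym/eqP; rewrite component_eq.
by rewrite add1n addSn subnK // subset_leq_card.
Qed.

End ComponentCount.

(** * Extension by a largest vertex and its effect on the statistics *)

Lemma laguerreP n (G : digraph n) :
  reflect ((forall i j k, (i, j) \in G -> (i, k) \in G -> j = k) /\
           (forall i j k, (i, k) \in G -> (j, k) \in G -> i = j))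
          (is_laguerre G).
Proof.
apply: (iffP idP) => [lagG|[sG pG]].
  by split=> i j k; [exact: laguerre_succ_inj | exact: laguerre_pred_inj].
apply/forallP => i; apply/andP; split; apply/card_le1_eqP => j k; rewrite !inE.
  by move=> ji ki; exact: pG ki ji.
by move=> ij ik; exact: sG ik ij.
Qed.

Lemma bump_ord n (i : 'I_n) : bump n i = i.
Proof. by rewrite /bump leqNgt ltn_ord. Qed.

Lemma lt_inf_old n (x y : option 'I_n) :
  lt_inf (omap old x) (omap old y) = lt_inf x y.
Proof. by case: x y => [x|] [y|] //=; rewrite !bump_ord. Qed.

(* The new vertex [ord_max] is isolated when [o = None], and is inserted
   between [u] and [v] when [o = Some (u, v)]. *)
Definition extend n (G : digraph n) (o : option ('I_n * 'I_n)) : digraph n.+1 :=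
  [set e | match unlift ord_max e.1, unlift ord_max e.2 with
           | Some x, Some y => (x, y) \in G
           | Some x, None => omap fst o == Some x
           | None, Some y => omap snd o == Some y
           | None, None => false
           end].

(** The case [u = v] is allowed: an isolated vertex then becomes part of a 2-cycle. *)
Definition extendable n (G : digraph n) (o : option ('I_n * 'I_n)) : bool :=
  is_laguerre G && if o is Some (u, v) then (u \in ends G) && (v \in starts G) else true.

Section Extend.
Variables (n : nat) (G : digraph n) (o : option ('I_n * 'I_n)).
Let H := extend G o.

Lemma extend_old_old x y : ((old x, old y) \in H) = ((x, y) \in G).
Proof. by rewrite inE /= !liftK. Qed.

Lemma extend_old_max x : ((old x, ord_max) \in H) = (omap fst o == Some x).
Proof. by rewrite inE /= liftK unlift_none. Qed.

Lemma extend_max_old y : ((ord_max, old y) \in H) = (omap snd o == Some y).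
Proof. by rewrite inE /= liftK unlift_none. Qed.

Lemma extend_max_max : ((ord_max, ord_max) \in H) = false.
Proof. by rewrite inE /= unlift_none. Qed.

Definition extendE := (extend_old_old, extend_old_max, extend_max_old, extend_max_max).

Lemma restrict_extend : restrict H = G.
Proof. by apply/setP => -[x y]; rewrite !inE /= !liftK. Qed.

Lemma laguerre_extend : is_laguerre H = extendable G o.
Proof.
apply/laguerreP/andP => [[sH pH]|[lagG val_o]].
  split.
    apply/laguerreP; split=> i j k.
      by rewrite -!extend_old_old => /sH e /e /lift_inj.
    by rewrite -!extend_old_old => /pH e /e /lift_inj.
  case eo: o => [[u v]|] //; apply/andP; split.
    apply/endsP => j; apply/negP; rewrite -extend_old_old => uj.
    have := sH _ _ ord_max uj; rewrite extend_old_max eo eqxx => /(_ isT)/esym/eqP.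
    by rewrite (negPf (neq_lift _ _)).
  apply/startsP => j; apply/negP; rewrite -extend_old_old => jv.
  have := pH _ ord_max _ jv; rewrite extend_max_old eo eqxx => /(_ isT)/esym/eqP.
  by rewrite (negPf (neq_lift _ _)).
have end_o x y : omap fst o == Some x -> (x, y) \notin G.
  case: (o) val_o => [[u v]|] //= /andP[ue _] /eqP[<-].
  exact: (endsP _ _ ue).
have start_o x y : omap snd o == Some y -> (x, y) \notin G.
  case: (o) val_o => [[u v]|] //= /andP[_ vs] /eqP[<-].
  exact: (startsP _ _ vs).
split=> i j k; case: (unliftP ord_max i) => [{}i ->|->];
  case: (unliftP ord_max j) => [{}j ->|->];
  case: (unliftP ord_max k) => [{}k ->|->]; rewrite !extendE //.
- by move=> ij ik; rewrite (laguerre_succ_inj lagG ij ik).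
- by move=> + /end_o/negP e => /e.
- by move=> /end_o/negP e /e.
- by move=> /eqP-> /eqP[->].
- by move=> ik jk; rewrite (laguerre_pred_inj lagG ik jk).
- by move=> /eqP-> /eqP[->].
- by move=> + /start_o/negP e => /e.
- by move=> /start_o/negP e /e.
Qed.

Hypothesis extG : extendable G o.
Let lagG : is_laguerre G. Proof. by case/andP: extG. Qed.
Let lagH : is_laguerre H. Proof. by rewrite laguerre_extend. Qed.

Lemma succ_extend x :
  succ_inf H (old x) =
  if omap fst o == Some x then Some ord_max else omap old (succ_inf G x).
Proof.
case: ifPn => ox; first by apply/eqP; rewrite succ_infE // extend_old_max.
case Gx: (succ_inf G x) => [y|] /=; apply/eqP.
  by rewrite succ_infE // extend_old_old -succ_infE // Gx.
have /endsP xe : x \in ends G by rewrite inE Gx.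
suff: old x \in ends H by rewrite inE.
apply/endsP => j; case: (unliftP ord_max j) => [y ->|->]; rewrite extendE //.
Qed.

Lemma pred_extend y :
  pred_inf H (old y) =
  if omap snd o == Some y then Some ord_max else omap old (pred_inf G y).
Proof.
case: ifPn => oy; first by apply/eqP; rewrite pred_infE // extend_max_old.
case Gy: (pred_inf G y) => [x|] /=; apply/eqP.
  by rewrite pred_infE // extend_old_old -pred_infE // Gy.
have /startsP ys : y \in starts G by rewrite inE Gy.
suff: old y \in starts H by rewrite inE.
apply/startsP => j; case: (unliftP ord_max j) => [x ->|->]; rewrite extendE //.
Qed.

Lemma succ_extend_max : succ_inf H ord_max = omap (fun p => old p.2) o.
Proof.
case eo: o => [[u v]|] /=; apply/eqP.
  by rewrite succ_infE // extend_max_old eo /= eqxx.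
suff: ord_max \in ends H by rewrite inE.
by apply/endsP => j; case: (unliftP ord_max j) => [y ->|->]; rewrite extendE // eo.
Qed.

Lemma pred_extend_max : pred_inf H ord_max = omap (fun p => old p.1) o.
Proof.
case eo: o => [[u v]|] /=; apply/eqP.
  by rewrite pred_infE // extend_old_max eo /= eqxx.
suff: ord_max \in starts H by rewrite inE.
by apply/startsP => j; case: (unliftP ord_max j) => [y ->|->]; rewrite extendE // eo.
Qed.

Let succ_end x : omap fst o == Some x -> succ_inf G x = None.
Proof.
case: (o) extG => [[u v]|] //= /andP[_ /andP[ue _]] /eqP[<-].
by apply/eqP; move: ue; rewrite inE.
Qed.

Let pred_start y : omap snd o == Some y -> pred_inf G y = None.
Proof.
case: (o) extG => [[u v]|] //= /andP[_ /andP[_ vs]] /eqP[<-].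
by apply/eqP; move: vs; rewrite inE.
Qed.

Let max_gt (i : 'I_n) : old i < (ord_max : 'I_n.+1).
Proof. by rewrite /= bump_ord. Qed.

Let max_ngt (i : 'I_n) : (ord_max : 'I_n.+1) < old i = false.
Proof. by rewrite ltnNge ltnW. Qed.

(** Where a neighbour changes, [ord_max] replaces infinity, and both exceed every old vertex. The
    same reason gives the next three lemmas. *)
Lemma lt_succ_extend i x :
  lt_inf (Some (old i)) (succ_inf H (old x)) = lt_inf (Some i) (succ_inf G x).
Proof.
rewrite succ_extend; case: ifPn => [/succ_end -> /=|_]; first exact: max_gt.
exact: lt_inf_old (Some i) _.
Qed.

Lemma succ_extend_lt i x :
  lt_inf (succ_inf H (old x)) (Some (old i)) = lt_inf (succ_inf G x) (Some i).
Proof.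
rewrite succ_extend; case: ifPn => [/succ_end -> /=|_]; first exact: max_ngt.
exact: lt_inf_old _ (Some i).
Qed.

Lemma lt_pred_extend i x :
  lt_inf (Some (old i)) (pred_inf H (old x)) = lt_inf (Some i) (pred_inf G x).
Proof.
rewrite pred_extend; case: ifPn => [/pred_start -> /=|_]; first exact: max_gt.
exact: lt_inf_old (Some i) _.
Qed.

Lemma pred_extend_lt i x :
  lt_inf (pred_inf H (old x)) (Some (old i)) = lt_inf (pred_inf G x) (Some i).
Proof.
rewrite pred_extend; case: ifPn => [/pred_start -> /=|_]; first exact: max_ngt.
exact: lt_inf_old _ (Some i).
Qed.

Lemma valley_extend x : is_valley H (old x) = is_valley G x.
Proof. by rewrite /is_valley lt_succ_extend lt_pred_extend. Qed.

Lemma peak_extend x : is_peak H (old x) = is_peak G x.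
Proof. by rewrite /is_peak succ_extend_lt pred_extend_lt. Qed.

Lemma valley_extend_max : is_valley H ord_max = ~~ isSome o.
Proof.
rewrite /is_valley succ_extend_max pred_extend_max.
by case: o => [[u v]|] //=; rewrite max_ngt.
Qed.

Lemma peak_extend_max : is_peak H ord_max = isSome o.
Proof.
rewrite /is_peak succ_extend_max pred_extend_max.
by case: o => [[u v]|] //=; rewrite !max_gt.
Qed.

(** The new vertex is a valley if isolated and a peak otherwise, while comparisons and loops at old
    vertices are unchanged. *)
Lemma alternating_extend : alternating H = alternating G.
Proof.
have oldE x : [&& ~~ is_dasc H (old x), ~~ is_ddesc H (old x) & ~~ is_fixpt H (old x)] =
    [&& ~~ is_dasc G x, ~~ is_ddesc G x & ~~ is_fixpt G x].
  rewrite /is_dasc /is_ddesc /is_fixpt lt_succ_extend lt_pred_extend.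
  rewrite succ_extend_lt pred_extend_lt !pred_infE // !succ_infE //.
  by rewrite !extend_old_old.
apply/forallP/forallP => altG x; first by rewrite -oldE.
case: (unliftP ord_max x) => [y ->|->]; first by rewrite oldE.
rewrite /is_dasc /is_ddesc /is_fixpt succ_extend_max pred_extend_max.
case: o => [[u v]|] //=; rewrite !max_ngt andbF /=.
by apply/nandP; left; rewrite (inj_eq Some_inj) eq_sym neq_lift.
Qed.

Lemma starts_extend_old y : (old y \in starts H) = (y \in starts G) && (omap snd o != Some y).
Proof.
by rewrite !inE pred_extend; case: (omap snd o =P Some y) => _; rewrite ?andbF ?andbT //; case: pred_inf.
Qed.

Lemma starts_extend_max : (ord_max \in starts H) = ~~ isSome o.
Proof. by rewrite inE pred_extend_max; case: o. Qed.

(** Counting by starts: an isolated new vertex is one more start, whereas a peak removes the start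
    [v]. *)
Lemma npaths_extend : npaths H + isSome o = npaths G + ~~ isSome o.
Proof.
rewrite !npaths_starts // -[#|starts H|]sum1_card big_mkcond big_ord_recr /= starts_extend_max.
have -> : \sum_(i < n) (if widen_ord (leqnSn n) i \in starts H then 1 else 0) =
    #|starts G :\: [set y | omap snd o == Some y]|.
  rewrite -sum1_card [RHS]big_mkcond; apply: eq_bigr => i _.
  have -> : widen_ord (leqnSn n) i = old i by apply: val_inj; rewrite /= bump_ord.
  by rewrite starts_extend_old !inE andbC.
case: (o) extG => [[u v]|] /= /andP[_ val_o].
  case/andP: val_o => _ vs; rewrite addn0 addn0 (cardsD1 v (starts G)) vs addnC.
  congr (_ + #|pred_of_set _|); apply/setP => y; rewrite !inE andbC.
  by rewrite (inj_eq Some_inj) andbC eq_sym.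
rewrite addn0; congr (#|pred_of_set _| + _).
by apply/setP => y; rewrite !inE.
Qed.

Lemma card_components_extend :
  #|components H| + (if o is Some (u, v) then #|[set component G u; component G v]| else 0) =
  #|components G|.+1.
Proof.
have := card_components_add_vertex H; rewrite restrict_extend => <-.
congr (_ + _); case eo: o => [[u v]|].
  congr #|pred_of_set _|; apply/setP => C; rewrite !inE; apply/orP/imsetP.
    by case=> /eqP ->; [exists u | exists v];
      rewrite // inE /adjacent /= !extendE eo /= eqxx ?orbT.
  case=> x; rewrite inE /adjacent /= !extendE eo => /orP[] /eqP[<-] ->; first by right.
  by left.
apply/esym/eqP; rewrite cards_eq0; apply/eqP/setP => C; rewrite in_set0; apply/imsetP.
by case=> x; rewrite inE /adjacent /= !extendE eo.
Qed.

(** An isolated vertex raises both components and paths by one. A peak lowers the paths by one, and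
    lowers the components by one only if [u] and [v] lie in different components; otherwise a cycle
    is created. *)
Lemma cyc_extend :
  cyc H = cyc G + (if o is Some (u, v) then connect (adjacent G) v u : nat else 0).
Proof.
have eqc := card_components_extend; have eqn := npaths_extend.
rewrite -!cyc_npaths // in eqc.
move: eqc eqn; case: o => [[u v]|] /=; rewrite !addn0 ?addn1.
  rewrite cards2 component_eq connect_adjacent_sym => eqc eqn.
  move: eqc; rewrite -eqn addnS; case: connect => /=.
    by rewrite addn0 addn1 => -[]; rewrite addnS -addSn => /addIn.
  by rewrite addn1 addn0 addnS => -[] /addIn.
by move=> eqc eqn; move: eqc; rewrite eqn addnS => -[] /addIn.
Qed.

(** The new vertex is never below [j], so only old vertices are counted. *)
Lemma ulev_extend j : ulev H (old j) = ulev G j.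
Proof.
rewrite /ulev lt_succ_extend; case: ifP => // _.
rewrite -[RHS](card_imset _ (@lift_inj _ ord_max)); apply: eq_card => i; rewrite !inE.
apply/andP/imsetP => [[]|[x]].
  case: (unliftP ord_max i) => [x ->|->]; last by rewrite max_ngt.
  rewrite lt_succ_extend => xj lx; exists x => //.
  by move: xj; rewrite /= !bump_ord inE => ->.
by rewrite inE => /andP[xj lx] ->; rewrite lt_succ_extend lx /= !bump_ord.
Qed.

(** Only infinity exceeds [ord_max], so the vertices counted are the path ends. *)
Lemma ulev_extend_max : ~~ isSome o -> ulev H ord_max = #|ends G|.
Proof.
move=> eo; have No : omap fst o = None by case: o eo.
rewrite /ulev; have -> : succ_inf H ord_max = None by rewrite succ_extend_max; case: o eo.
rewrite -[RHS](card_imset _ (@lift_inj _ ord_max)); apply: eq_card => i; rewrite !inE.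
apply/andP/imsetP => [[]|[x]].
  case: (unliftP ord_max i) => [x ->|->]; last by rewrite ltnn.
  rewrite succ_extend No /= => _; case Gx: succ_inf => [y|]; first by rewrite /= bump_ord ltnNge ltnW.
  by exists x; rewrite ?inE ?Gx.
by rewrite inE => /eqP xe ->; rewrite succ_extend No xe.
Qed.

End Extend.

(** * Crossings and nestings *)

Section CrossNest.
Variables (n : nat).
Implicit Types (G : digraph n).

(** The third coordinate of a triple is determined as the predecessor of the second; in [lnestE], of
    the first. *)
Lemma lcrossE G k : lcross G k =
  #|[set x : 'I_n * 'I_n | [&& x.1 < x.2, x.2 < k, pred_inf G x.1 == Some k
                             & lt_inf (Some k) (pred_inf G x.2)]]|.
Proof.
rewrite -[RHS](card_imset _ (f := fun x => (x.1, x.2, pred_inf G x.2))); last first.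
  by move=> [i j] [i' j'] /= [-> ->].
apply: eq_card => -[[i j] l]; rewrite inE; apply/and5P/imsetP.
  by case=> ij jk kl pi /eqP pj; exists (i, j); rewrite ?inE /= ?ij ?jk ?pi pj ?kl.
by case=> -[i' j']; rewrite inE /= => /and4P[ij jk pi kl] [-> -> ->]; split.
Qed.

Lemma lnestE G k : lnest G k =
  #|[set x : 'I_n * 'I_n | [&& x.1 < x.2, x.2 < k, pred_inf G x.2 == Some k
                             & lt_inf (Some k) (pred_inf G x.1)]]|.
Proof.
rewrite -[RHS](card_imset _ (f := fun x => (x.1, x.2, pred_inf G x.1))); last first.
  by move=> [i j] [i' j'] /= [-> ->].
apply: eq_card => -[[i j] l]; rewrite inE; apply/and5P/imsetP.
  by case=> ij jk kl pi /eqP pj; exists (i, j); rewrite ?inE /= ?ij ?jk ?pi pj ?kl.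
by case=> -[i' j']; rewrite inE /= => /and4P[ij jk pi kl] [-> -> ->]; split.
Qed.

End CrossNest.

Section CrossNestExtend.
Local Arguments lt_inf : simpl never.
Variables (n : nat) (G : digraph n) (o : option ('I_n * 'I_n)).
Let H := extend G o.
Hypothesis extG : extendable G o.
Let lagG : is_laguerre G. Proof. by case/andP: extG. Qed.
Let lagH : is_laguerre H. Proof. by rewrite laguerre_extend. Qed.

Let pred_old x k : (pred_inf H (old x) == Some (old k)) = (pred_inf G x == Some k).
Proof. by rewrite !pred_infE // extend_old_old. Qed.

Let old2_inj : injective (fun x : 'I_n * 'I_n => (old x.1, old x.2)).
Proof. by move=> [i j] [i' j'] [] /eqP; rewrite /= !bump_ord => /eqP/val_inj-> /val_inj->. Qed.

(** [i < j < k] with [k] old forces [i] and [j] to be old, and the conditions on their predecessors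
    are unchanged. *)
Lemma lcross_extend k : lcross H (old k) = lcross G k.
Proof.
rewrite !lcrossE -[RHS](card_imset _ old2_inj); apply: eq_card => -[i j]; rewrite inE /=.
apply/and4P/imsetP => [[]|[[x y]]].
  case: (unliftP ord_max j) => [y ->|->]; last first.
    by move=> _; rewrite /= ltnNge bump_ord ltnW.
  case: (unliftP ord_max i) => [x ->|->]; first last.
    by rewrite /= ltnNge bump_ord ltnW.
  rewrite pred_old lt_pred_extend //= !bump_ord => xy yk px ly.
  by exists (x, y); rewrite // inE /= xy yk px ly.
rewrite inE /= => /and4P[xy yk px ly] [-> ->].
by rewrite pred_old lt_pred_extend //= !bump_ord.
Qed.

Lemma lnest_extend k : lnest H (old k) = lnest G k.
Proof.
rewrite !lnestE -[RHS](card_imset _ old2_inj); apply: eq_card => -[i j]; rewrite inE /=.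
apply/and4P/imsetP => [[]|[[x y]]].
  case: (unliftP ord_max j) => [y ->|->]; last first.
    by move=> _; rewrite /= ltnNge bump_ord ltnW.
  case: (unliftP ord_max i) => [x ->|->]; first last.
    by rewrite /= ltnNge bump_ord ltnW.
  rewrite pred_old lt_pred_extend //= !bump_ord => xy yk px ly.
  by exists (x, y); rewrite // inE /= xy yk px ly.
rewrite inE /= => /and4P[xy yk px ly] [-> ->].
by rewrite pred_old lt_pred_extend //= !bump_ord.
Qed.

End CrossNestExtend.

Local Open Scope ring_scope.

(** * Last-step recurrence for lattice paths *)

Section Paths.
Variables (R : comNzRingType) (beta gamma : nat -> R).

Lemma big_mstep (F : mstep -> R) : \sum_s F s = F Rise + F Level + F Fall.
Proof.
rewrite (bigD1 Rise) //= (bigD1 Level) //= (bigD1 Fall) //= big1 ?addr0 ?addrA //.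
by case.
Qed.

Lemma big_rcons_tuple n (P : pred (n.+1.-tuple mstep)) (F : n.+1.-tuple mstep -> R) :
  \sum_(w | P w) F w =
  \sum_s \sum_(w : n.-tuple mstep | P [tuple of rcons w s]) F [tuple of rcons w s].
Proof.
pose unrcons (w : n.+1.-tuple mstep) : mstep * n.-tuple mstep :=
  (last (thead w) (behead w), [tuple of belast (thead w) (behead w)]).
rewrite pair_big_dep.
rewrite (reindex (fun p : mstep * n.-tuple mstep => [tuple of rcons p.2 p.1])) //.
exists unrcons => [[s w]|w] _.
  rewrite /unrcons; congr (_, _); last apply: val_inj.
    by case: w => -[|x w] //= i; rewrite /thead (tnth_nth s) //= last_rcons.
  by case: w => -[|x w] //= i; rewrite /thead !(tnth_nth s) //= belast_rcons.
apply: val_inj; rewrite /unrcons /= -lastI.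
by case/tupleP: w => x w; rewrite theadE.
Qed.

Lemma height_rcons (w : seq mstep) s m : (m <= size w)%N -> height (rcons w s) m = height w m.
Proof. by move=> mw; rewrite /height -cats1 takel_cat. Qed.

Lemma height_size_rcons (w : seq mstep) s :
  height (rcons w s) (size w).+1 = height w (size w) + dy s.
Proof.
rewrite /height take_oversize ?size_rcons // take_size.
by rewrite -cats1 big_cat /= big_seq1.
Qed.

(** The final height equals [k], so its nonnegativity is automatic and only the earlier heights are
    constrained. *)
Lemma is_lattice_path_rcons n k (w : n.-tuple mstep) s :
  is_lattice_path k [tuple of rcons w s] =
  [forall m : 'I_n.+1, 0 <= height w m] && (height w n + dy s == k%:Z).
Proof.
have hn : height (rcons w s) n.+1 = height w n + dy s.
  by have := height_size_rcons w s; rewrite size_tuple.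
rewrite /is_lattice_path /= hn; case: eqP => [eqk|_]; rewrite ?andbF // !andbT.
apply/forallP/forallP => pos m.
  have := pos (widen_ord (leqnSn _) m); rewrite /= height_rcons //.
  by rewrite size_tuple -ltnS.
case: (unliftP ord_max m) => [i ->|->]; last by rewrite /= hn eqk.
rewrite lift_max height_rcons ?pos // size_tuple -ltnS; exact: ltn_ord.
Qed.

Lemma path_weight_rcons n (w : n.-tuple mstep) s :
  path_weight beta gamma [tuple of rcons w s] =
  path_weight beta gamma w *
  match s with
  | Rise => 1
  | Level => gamma `|height w n|%N
  | Fall => beta `|height w n|%N
  end.
Proof.
rewrite /path_weight big_ord_recr /=; congr (_ * _); last first.
  rewrite height_rcons ?size_tuple //.
  by rewrite (tnth_nth s) /= nth_rcons size_tuple ltnn eqxx.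
apply: eq_bigr => i _; rewrite height_rcons ?size_tuple; last exact: ltnW.
by rewrite !(tnth_nth s) /= nth_rcons size_tuple ltn_ord.
Qed.

End Paths.

Lemma J0 (R : comNzRingType) (beta gamma : nat -> R) k : J 0 k beta gamma = (k == 0%N)%:R.
Proof.
rewrite /J /path_weight; under eq_bigr do rewrite big_ord0.
rewrite big_mkcond (eq_bigr (fun _ => (k == 0%N)%:R)).
  by rewrite sumr_const card_tuple expn0 mulr1n.
move=> w _; rewrite /is_lattice_path tuple0 /height /= big_nil eq_sym eqz_nat.
have -> : [forall m : 'I_1, (0 : int) <= 0] by apply/forallP.
by case: eqP.
Qed.

(** Split by the last step: a level step has weight 0, a rise comes from height [k - 1], a fall from
    height [k + 1]. *)
Lemma JS (R : comNzRingType) (beta : nat -> R) n k :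
  J n.+1 k beta (fun _ => 0) =
  (if k is k'.+1 then J n k' beta (fun _ => 0) else 0) + beta k.+1 * J n k.+1 beta (fun _ => 0).
Proof.
rewrite /J big_rcons_tuple big_mstep.
rewrite [X in _ + X + _]big1; last by move=> w _; rewrite path_weight_rcons mulr0.
rewrite addr0; congr (_ + _).
  under eq_bigr do rewrite path_weight_rcons mulr1.
  case: k => [|k].
    (* A final rise to height 0 would start at height -1. *)
    rewrite big_pred0 // => w; rewrite is_lattice_path_rcons; apply/negP => /andP[/forallP pos].
    have /= := pos ord_max; case: (height w n) => // m _; by rewrite -PoszD addn1.
  apply: eq_bigl => w; rewrite is_lattice_path_rcons /is_lattice_path.
  by congr (_ && _); rewrite -addn1 PoszD (inj_eq (addIr 1)).
rewrite mulr_sumr; apply: eq_big => w.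
  rewrite is_lattice_path_rcons /is_lattice_path; congr (_ && _).
  by rewrite /= subr_eq -PoszD addn1.
rewrite is_lattice_path_rcons path_weight_rcons mulrC => /andP[_].
by rewrite /= subr_eq -PoszD addn1 => /eqP ->.
Qed.

(** * Recurrence for the weighted digraphs *)

Section InsertPeak.
Variables (n : nat) (G : digraph n) (u v : 'I_n).
Let H := extend G (Some (u, v)).
Hypothesis extG : extendable G (Some (u, v)).
Let lagH : is_laguerre H. Proof. by rewrite laguerre_extend. Qed.

Let pred_max x : (pred_inf H (old x) == Some ord_max) = (x == v).
Proof. by rewrite pred_infE // extend_max_old /= (inj_eq Some_inj) eq_sym. Qed.

(** Only infinity exceeds [ord_max]; [v] is excluded since it stops being a start. *)
Let max_lt_pred y : y != v ->
  lt_inf (Some ord_max) (pred_inf H (old y)) = (y \in starts G).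
Proof.
move=> yv; rewrite pred_extend // (inj_eq Some_inj) eq_sym (negPf yv) inE.
by case: pred_inf => [x|] //=; rewrite bump_ord ltnNge ltnW.
Qed.

Let max_nlt (i : 'I_n.+1) : ((ord_max : 'I_n.+1) < i)%N = false.
Proof. by rewrite ltnNge -ltnS ltn_ord. Qed.

(** The vertex with predecessor [ord_max] is [v], so [i = v] and [j] is a start above it, with [l]
    infinite. For [lnest] the roles of [i] and [j] are exchanged. *)
Lemma lcross_extend_max : lcross H ord_max = #|[set y in starts G | (v < y)%N]|.
Proof.
rewrite lcrossE -[RHS](card_imset _ (f := fun y => (old v, old y))); last first.
  by move=> y y' [] /eqP; rewrite !bump_ord => /eqP/val_inj.
apply: eq_card => -[i j]; rewrite inE; apply/and4P/imsetP => [[]|[y]].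
  rewrite [(_, _).1]/= [(_, _).2]/=.
  case: (unliftP ord_max j) => [y ->|-> _]; last by rewrite ltnn.
  case: (unliftP ord_max i) => [x ->|->]; last by rewrite max_nlt.
  rewrite !lift_max pred_max => xy _ /eqP eq_xv; rewrite eq_xv in xy *.
  rewrite max_lt_pred; last by apply: contraTneq xy => ->; rewrite ltnn.
  by move=> ys; exists y; rewrite // inE ys xy.
rewrite inE => /andP[ys vy] [-> ->]; rewrite [(_, _).1]/= [(_, _).2]/=.
rewrite !lift_max pred_max max_lt_pred //; last by apply: contraTneq vy => ->; rewrite ltnn.
Qed.

Lemma lnest_extend_max : lnest H ord_max = #|[set y in starts G | (y < v)%N]|.
Proof.
rewrite lnestE -[RHS](card_imset _ (f := fun y => (old y, old v))); last first.
  by move=> y y' [] /eqP; rewrite !bump_ord => /eqP/val_inj.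
apply: eq_card => -[i j]; rewrite inE; apply/and4P/imsetP => [[]|[y]].
  rewrite [(_, _).1]/= [(_, _).2]/=.
  case: (unliftP ord_max j) => [y ->|-> _]; last by rewrite ltnn.
  case: (unliftP ord_max i) => [x ->|->]; last by rewrite max_nlt.
  rewrite !lift_max pred_max => xy _ /eqP eq_yv; rewrite eq_yv in xy *.
  rewrite max_lt_pred; last by apply: contraTneq xy => ->; rewrite ltnn.
  by move=> xs; exists x; rewrite // inE xs xy.
rewrite inE => /andP[ys vy] [-> ->]; rewrite [(_, _).1]/= [(_, _).2]/=.
rewrite !lift_max pred_max max_lt_pred //; last by apply: contraTneq vy => ->; rewrite ltnn.
Qed.

End InsertPeak.

(** * Weights and their sum over all insertions of a peak *)

Section Weight.
Variables (R : comNzRingType) (a : nat -> R) (b : nat -> nat -> R) (lam : R).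

Definition weight n (G : digraph n) : R :=
  lam ^+ cyc G * (\prod_(i in Val G) a (ulev G i))
               * (\prod_(i in Peak G) b (lcross G i) (lnest G i)).

Lemma prod_ord_max n (P : pred 'I_n.+1) (F : 'I_n.+1 -> R) :
  \prod_(i | P i) F i =
  (\prod_(i < n | P (old i)) F (old i)) * (if P ord_max then F ord_max else 1).
Proof.
rewrite big_mkcond big_ord_recr /= [X in _ = X * _]big_mkcond.
congr (_ * _); apply: eq_bigr => i _.
by have -> : widen_ord (leqnSn n) i = old i by apply: val_inj; rewrite /= bump_ord.
Qed.

Lemma prod_Val_extend n (G : digraph n) o : extendable G o ->
  \prod_(i in Val (extend G o)) a (ulev (extend G o) i) =
  (\prod_(i in Val G) a (ulev G i)) * (if isSome o then 1 else a #|ends G|).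
Proof.
move=> extG; rewrite prod_ord_max inE valley_extend_max //; congr (_ * _).
  by apply: eq_big => i; rewrite ?inE ?valley_extend // => _; rewrite ulev_extend.
by case: o extG => // extG; rewrite ulev_extend_max.
Qed.

Lemma prod_Peak_extend n (G : digraph n) o : extendable G o ->
  \prod_(i in Peak (extend G o)) b (lcross (extend G o) i) (lnest (extend G o) i) =
  (\prod_(i in Peak G) b (lcross G i) (lnest G i)) *
  (if o is Some (u, v) then
     b #|[set y in starts G | (v < y)%N]| #|[set y in starts G | (y < v)%N]| else 1).
Proof.
move=> extG; rewrite prod_ord_max inE peak_extend_max //; congr (_ * _).
  apply: eq_big => i; rewrite ?inE ?peak_extend // => _.
  by rewrite lcross_extend // lnest_extend.
by case: o extG => // -[u v] extG; rewrite lcross_extend_max // lnest_extend_max.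
Qed.

Lemma weight_extend_None n (G : digraph n) : is_laguerre G ->
  weight (extend G None) = a #|ends G| * weight G.
Proof.
move=> lagG; have extG : extendable G None by rewrite /extendable lagG.
rewrite /weight cyc_extend // prod_Val_extend // prod_Peak_extend //= addn0 mulr1.
by rewrite [RHS]mulrC -!mulrA; congr (_ * (_ * _)); rewrite mulrC.
Qed.

Lemma weight_extend_Some n (G : digraph n) u v : is_laguerre G ->
  u \in ends G -> v \in starts G ->
  weight (extend G (Some (u, v))) =
  weight G * (b #|[set y in starts G | (v < y)%N]| #|[set y in starts G | (y < v)%N]|
              * lam ^+ (u \in component G v)).
Proof.
move=> lagG ue vs; have extG : extendable G (Some (u, v)) by rewrite /extendable lagG ue.
rewrite /weight cyc_extend // prod_Val_extend // prod_Peak_extend //= mulr1.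
rewrite mem_component exprD (mulrAC (lam ^+ cyc G)) -!mulrA.
by congr (_ * (_ * _)); rewrite mulrC mulrA.
Qed.

Lemma sum_exp_mem (T : finType) (A C : {set T}) :
  \sum_(u in A) lam ^+ (u \in C) = lam *+ #|A :&: C| + 1 *+ #|A :\: C|.
Proof.
rewrite (bigID [in C]) /=; congr (_ + _).
  rewrite -sumr_const; apply: eq_big => u; first by rewrite inE.
  by case/andP=> _ ->.
rewrite -sumr_const; apply: eq_big => u; first by rewrite inE andbC.
by case/andP=> _ /negPf ->.
Qed.

(** As [v] runs through [S], the number of elements above it takes each value from 0 to [#|S| - 1]
    once, and the number below is the complement. *)
Lemma sum_rank n (S : {set 'I_n}) (F : nat -> nat -> R) :
  \sum_(v in S) F #|[set y in S | (v < y)%N]| #|[set y in S | (y < v)%N]| =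
  \sum_(l < #|S|) F l (#|S| - 1 - l)%N.
Proof.
case cS: #|S| => [|m].
  by rewrite (cards0_eq cS) big_set0 big_ord0.
pose h (v : 'I_n) := #|[set y in S | (v < y)%N]|.
have hg v : v \in S -> (#|[set y in S | (y < v)%N]| + h v)%N = m.
  move=> vS; apply/eqP; rewrite -eqSS -cS (cardsD1 v S) vS add1n eqSS; apply/eqP.
  rewrite -(cardsID [set y : 'I_n | (y < v)%N] (S :\ v)).
  by congr addn; apply: eq_card => y; rewrite !inE -val_eqE /=;
    case: (y \in S); case: ltngtP.
have h_lt (v v' : 'I_n) : v' \in S -> (v < v')%N -> (h v' < h v)%N.
  move=> v'S vv'; apply/proper_card/properP; split.
    by apply/subsetP => y; rewrite !inE => /andP[-> /(ltn_trans vv')].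
  by exists v'; rewrite !inE v'S ?vv' ?ltnn.
have h_le v : v \in S -> (h v < m.+1)%N by move=> vS; rewrite ltnS -(hg v vS) leq_addl.
pose k v : 'I_m.+1 := inord (h v).
have k_inj : {in S &, injective k}.
  move=> v v' vS v'S /(congr1 val); rewrite /= !inordK ?h_le // => eqh.
  apply: val_inj; case: (ltngtP v v') => //= /h_lt lt.
    by have := lt v'S; rewrite eqh ltnn.
  by have := lt vS; rewrite eqh ltnn.
(* An injective map from [S] into a set of the same size is onto. *)
have imS : [set k v | v in S] = [set: 'I_m.+1].
  by apply/eqP; rewrite eqEcard subsetT /= cardsT card_ord (card_in_imset k_inj) cS.
transitivity (\sum_(l in [set: 'I_m.+1]) F l (m - l)%N).
  rewrite -imS big_imset //; apply: eq_bigr => v vS.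
  have -> : k v = h v :> nat by rewrite inordK ?h_le.
  by rewrite -(hg v vS) addnK.
by apply: eq_big => l; rewrite ?inE // subn1.
Qed.

(** For a fixed start [v], the sum over the ends gives [lam + k] whatever [v] is; the sum over [v]
    is then a sum over ranks. *)
Lemma sum_insertions n k (G : digraph n) : G \in LDalt n k.+1 ->
  \sum_(p | (p.1 \in ends G) && (p.2 \in starts G)) weight (extend G (Some p)) =
  weight G * ((lam + k%:R) * \sum_(l < k.+1) b l (k - l)%N).
Proof.
rewrite inE => /and3P[lagG _ /eqP npG].
rewrite -(pair_big (mem (ends G)) (mem (starts G)) (fun u v => weight (extend G (Some (u, v))))) /=.
rewrite exchange_big /=.
have es : #|ends G| = k.+1 by rewrite -npaths_ends.
have ss : #|starts G| = k.+1 by rewrite -npaths_starts.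
have := sum_rank (starts G) b; rewrite ss subn1 /= => <-.
rewrite !mulr_sumr; apply: eq_bigr => v vs.
under eq_bigr => u ue do rewrite weight_extend_Some //.
(* The end in the component of [v] contributes [lam], the [k] others 1 each. *)
rewrite -!mulr_sumr sum_exp_mem ends_of_start // mulr1n.
have := cardsID (component G v) (ends G); rewrite ends_of_start // es add1n => -[->].
by congr (_ * _); rewrite mulrC.
Qed.

End Weight.

(** * Deletion of the largest vertex as inverse of the extension *)

Section Restrict.
Variables (n : nat).

Definition connection (H : digraph n.+1) : option ('I_n * 'I_n) :=
  [pick p | ((old p.1, ord_max) \in H) && ((ord_max, old p.2) \in H)].

Lemma connection_extend (G : digraph n) o : connection (extend G o) = o.
Proof.
rewrite /connection; case: pickP => [[u v]|] /=.
  rewrite extend_old_max extend_max_old.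
  by case: o => [[u' v']|] //= /andP[/eqP[->] /eqP[->]].
case: o => [[u v]|] // /(_ (u, v)).
by rewrite extend_old_max extend_max_old /= !eqxx.
Qed.

Lemma extend_restrict (H : digraph n.+1) : is_laguerre H -> alternating H ->
  extend (restrict H) (connection H) = H.
Proof.
move=> lagH /forallP/(_ ord_max) altH.
(* With only a predecessor [ord_max] would be a double ascent, with only a successor a double
   descent, and with a loop a fixed point. *)
have nbrs : (pred_inf H ord_max = None /\ succ_inf H ord_max = None) \/
    exists u v, pred_inf H ord_max = Some (old u) /\ succ_inf H ord_max = Some (old v).
  move: altH; rewrite /is_dasc /is_ddesc /is_fixpt.
  have loop : (pred_inf H ord_max == Some ord_max) = (succ_inf H ord_max == Some ord_max).
    by rewrite pred_infE // succ_infE.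
  case eP: (pred_inf _ _) loop => [x|]; case eS: (succ_inf _ _) => [y|] //=.
  - case: (unliftP ord_max x) => [u ->|->]; case: (unliftP ord_max y) => [v ->|->].
    + by move=> _ _; right; exists u, v.
    + by rewrite eqxx (inj_eq Some_inj) eq_sym (negPf (neq_lift _ _)).
    + by rewrite eqxx (inj_eq Some_inj) eq_sym (negPf (neq_lift _ _)).
    + by rewrite !eqxx !andbF.
  - case: (unliftP ord_max x) => [u ->|->]; last by rewrite eqxx.
    by rewrite /= bump_ord ltn_ord.
  - case: (unliftP ord_max y) => [u ->|->]; last by rewrite eqxx.
    by rewrite /= bump_ord ltn_ord.
  - by left.
have [predC succC] : pred_inf H ord_max = omap (fun p => old p.1) (connection H) /\
                     succ_inf H ord_max = omap (fun p => old p.2) (connection H).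
  rewrite /connection; case: pickP => [[u v] /= /andP[uH vH]|no] /=.
    by split; apply/eqP; rewrite ?pred_infE ?succ_infE.
  case: nbrs => // -[u [v [/eqP P /eqP S]]].
  by move: (no (u, v)); rewrite /= -pred_infE // P -succ_infE // S.
apply/setP => -[i j].
case: (unliftP ord_max i) => [x ->|->]; case: (unliftP ord_max j) => [y ->|->];
  rewrite !extendE.
- by rewrite inE.
- rewrite -pred_infE // predC; case: connection => [[u v]|] //=.
  by rewrite !(inj_eq Some_inj) (inj_eq (@lift_inj _ _)).
- rewrite -succ_infE // succC; case: connection => [[u v]|] //=.
  by rewrite !(inj_eq Some_inj) (inj_eq (@lift_inj _ _)).
- rewrite -pred_infE // predC; case: connection => [[u v]|] //=.
  by rewrite (inj_eq Some_inj) eq_sym (negPf (neq_lift _ _)).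
Qed.

(** An isolated new vertex is itself a path, so it cannot occur when [k = 0]. *)
Lemma extend_LDalt k (G : digraph n) o : (extend G o \in LDalt n.+1 k) =
  match o with
  | Some (u, v) => [&& G \in LDalt n k.+1, u \in ends G & v \in starts G]
  | None => if k is k'.+1 then G \in LDalt n k' else false
  end.
Proof.
rewrite inE laguerre_extend; case: (boolP (extendable G o)) => [extG|] /=.
  rewrite alternating_extend //; have /andP[lagG val_o] := extG.
  have eqn := npaths_extend extG.
  case: o extG val_o eqn => [[u v]|] extG; rewrite ?addn0 ?addn1.
    by move=> /andP[-> ->] eqn; rewrite inE lagG /= -eqn eqSS !andbT.
  move=> _ ->; case: k => [|k]; first by rewrite andbF.
  by rewrite inE lagG.
move=> Nval; apply/esym/negbTE; apply: contra Nval; rewrite /extendable.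
case: o => [[u v]|]; first by case/andP; rewrite inE => /and3P[-> _ _] ->.
by case: k => // k; rewrite inE => /andP[->].
Qed.

End Restrict.

(** * Recurrence for the digraph polynomials and comparison with lattice paths *)

Lemma big_option (R : nmodType) (T : finType) (F : option T -> R) :
  \sum_o F o = F None + \sum_x F (Some x).
Proof.
rewrite (bigD1 None) //=; congr (_ + _).
rewrite -(big_imset _ (in2W Some_inj)); apply: eq_bigl => o.
apply/idP/imsetP => [|[x _ ->]] //; case: o => // x _; by exists x.
Qed.

Lemma QtildeS (R : comNzRingType) (a : nat -> R) (b : nat -> nat -> R) (lam : R) n k :
  Qtilde a b lam n.+1 k =
  (if k is k'.+1 then a k' * Qtilde a b lam n k' else 0) +
  (lam + k%:R) * (\sum_(l < k.+1) b l (k - l)%N) * Qtilde a b lam n k.+1.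
Proof.
have QE m j : Qtilde a b lam m j = \sum_(G in LDalt m j) weight a b lam G by [].
rewrite !QE (reindex_onto (fun p : digraph n * option ('I_n * 'I_n) => extend p.1 p.2)
  (fun H => (restrict H, connection H))); last first.
  by move=> H; rewrite inE => /and3P[lagH altH _]; exact: extend_restrict.
(* Extending and then deleting always returns the original pair, so the side condition of the
   reindexing disappears; [true] is the condition on the outer index of the double sum. *)
rewrite (eq_bigl (fun p => true && (extend p.1 p.2 \in LDalt n.+1 k))); last first.
  by move=> [G o]; rewrite restrict_extend connection_extend eqxx andbT.
rewrite -(pair_big_dep xpredT (fun G o => extend G o \in LDalt n.+1 k)
  (fun G o => weight a b lam (extend G o))) /=.
under eq_bigr do rewrite big_mkcond big_option extend_LDalt.
rewrite big_split /=; congr (_ + _).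
  case: k => [|k]; first by rewrite big1.
  rewrite -big_mkcond QE mulr_sumr; apply: eq_bigr => G.
  rewrite inE => /and3P[lagG _ /eqP <-].
  (* [G] has as many ends as paths, which gives the index of [a]. *)
  by rewrite weight_extend_None // npaths_ends.
rewrite mulr_sumr [RHS]big_mkcond; apply: eq_bigr => G _.
case: ifPn => [LG|LG].
  rewrite [RHS]mulrC -(sum_insertions a b lam LG) [RHS]big_mkcond.
  by apply: eq_bigr => -[u v] _; rewrite extend_LDalt LG.
by rewrite big1 // => -[u v] _; rewrite extend_LDalt (negPf LG).
Qed.

Lemma Qtilde0 (R : comNzRingType) (a : nat -> R) (b : nat -> nat -> R) (lam : R) k :
  Qtilde a b lam 0 k = (k == 0)%N%:R.
Proof.
have noI (A : {set 'I_0}) : A = set0 by apply/setP => -[].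
have LE G : (G \in LDalt 0 k) = (k == 0)%N.
  rewrite inE.
  have lagG : is_laguerre G by apply/forallP => -[].
  rewrite lagG npaths_starts // (noI (starts G)) cards0 eq_sym.
  by have -> : alternating G by apply/forallP => -[].
have G0 (G : digraph 0) : G = set0 by apply/setP => -[[]].
rewrite /Qtilde (eq_bigl _ _ LE) (eq_bigl _ _ (fun G => esym (andbT (k == 0%N)))).
rewrite big_mkcondl (eq_bigr (fun _ => (k == 0)%N%:R)); last first.
  move=> G _; case: (k == 0%N) => //.
  rewrite !big_pred0; [|by case..].
  (* Cycles are at most as many as components, and these at most as many as vertices. *)
  have -> : cyc G = 0%N.
    have lagG : is_laguerre G by apply/forallP => -[].
    apply/eqP; rewrite -leqn0 (leq_trans (leq_addr (npaths G) _)) // cyc_npaths //.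
    by rewrite componentsE; apply: leq_trans (leq_imset_card _ _) _; rewrite card_ord.
  by rewrite !mulr1.
rewrite (bigD1 set0) //= big1 ?addr0 // => G.
by rewrite (G0 G) eqxx.
Qed.

Theorem theorem6p6 (R : comNzRingType) (a : nat -> R) (b : nat -> nat -> R)
    (lam : R) (alpha : nat -> R)
    (halpha : forall m : nat, (1 <= m)%N ->
       alpha m = (lam + m%:R - 1) * a (m - 1)%N
                 * (\sum_(l < m) b l (m - 1 - l)%N))
    (n k : nat) :
  Qtilde a b lam n k = (\prod_(i < k) a i) * J n k alpha (fun _ : nat => 0).
Proof.
elim: n k => [|n IH] k.
  rewrite Qtilde0 J0; case: k => [|k]; last by rewrite mulr0.
  by rewrite big_ord0 mulr1.
rewrite QtildeS JS mulrDr; congr (_ + _).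
  (* The factor of the isolated vertex completes the product of the [a i] for one path fewer. *)
  by case: k => [|k]; rewrite ?mulr0 // IH big_ord_recr /= mulrA [a _ * _]mulrC.
(* The product for [k.+1] paths has the extra factor [a k], which is the one contained in
   [alpha k.+1]; there [lam + k.+1 - 1] becomes [lam + k]. *)
rewrite IH halpha // [\prod_(i < k.+1) a i]big_ord_recr /= subn1 /= -natr1 addrA addrK.
by move: (\prod_(i < k) a i) (\sum_(l < k.+1) _) (J _ _ _ _) => P B Jk; ring.
Qed.
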